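(* Let $\mathcal{X}$ be a non-empty finite set. Given a time-consistent family of exchangeable coherent lower previsions $\underline{P}^n$ on $\mathcal{L}(\mathcal{X}^n)$, $n \geq 1$, with corresponding count distributions $\underline{Q}^n$ on $\mathcal{L}(\mathcal{N}^n)$, there is a unique coherent lower prevision $\underline{R}$ on the linear space $\mathcal{V}(\Sigma)$ of all polynomial gambles on the $\mathcal{X}$-simplex $\Sigma$ such that for all $n \geq 1$, all $f \in \mathcal{L}(\mathcal{X}^n)$ and all $g \in \mathcal{L}(\mathcal{N}^n)$, $$\underline{P}^n(f) = \underline{R}\bigl(Mn^n(f|\cdot)\bigr) \quad\text{and}\quad \underline{Q}^n(g) = \underline{R}\bigl(CoMn^n(g|\cdot)\bigr).$$
   Context: A gamble on a non-empty set $Y$ is a bounded map $f: Y \to \mathbb{R}$; $\mathcal{L}(Y)$ is the linear space of all gambles on $Y$. A lower prevision on a linear space of gambles $\mathcal{K} \subseteq \mathcal{L}(Y)$ is a real-valued functional $\underline{P}: \mathcal{K} \to \mathbb{R}$; it is coherent if for all $f, g \in \mathcal{K}$ and all real $\lambda \geq 0$: (P1) $\underline{P}(f) \geq \inf f$; (P2) $\underline{P}(\lambda f) = \lambda \underline{P}(f)$; (P3) $\underline{P}(f+g) \geq \underline{P}(f) + \underline{P}(g)$. For a permutation $\pi$ of $\{1,\dots,n\}$ and $\mathbf{x} \in \mathcal{X}^n$, put $\pi\mathbf{x} := (x_{\pi(1)},\dots,x_{\pi(n)})$, and for $f \in \mathcal{L}(\mathcal{X}^n)$ let $(\pi f)(\mathbf{x})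 := f(\pi\mathbf{x})$. A coherent lower prevision $\underline{P}^n$ on $\mathcal{L}(\mathcal{X}^n)$ is exchangeable if $\underline{P}^n(\pi f - f) \geq 0$ for all $f \in \mathcal{L}(\mathcal{X}^n)$ and all permutations $\pi$ of $\{1,\dots,n\}$. A family $\underline{P}^n$ on $\mathcal{L}(\mathcal{X}^n)$, $n \geq 1$, is time consistent if $\underline{P}^n(f) = \underline{P}^{n+k}(\widetilde{f})$ for all $n \geq 1$, $k \geq 0$ and $f \in \mathcal{L}(\mathcal{X}^n)$, where $\widetilde{f}(z_1,\dots,z_{n+k}) := f(z_1,\dots,z_n)$ is the cylindrical extension of $f$ to $\mathcal{X}^{n+k}$. The set of count vectors is $\mathcal{N}^n := \{\mathbf{m} \in \mathbb{N}_0^{\mathcal{X}} : \sum_{x \in \mathcal{X}} m_x = n\}$, where $\mathbb{N}_0$ is the set of non-negative integers. The counting map $\mathbf{T}^n: \mathcal{X}^n \to \mathcal{N}^n$ has components $T^n_x(\mathbf{z}) := |\{k \in \{1,\dots,n\} : z_k = x\}|$, $x \in \mathcal{X}$. The count distribution $\underline{Q}^n$ corresponding to $\underline{P}^n$ is the coherent lower prevision on $\mathcal{L}(\mathcal{N}^n)$ given by $\underline{Q}^n(h) := \underline{P}^n(h \circ \mathbf{T}^n)$. For $\mathbf{m} \in \mathcal{N}^n$, $\nu(\mathbf{m}) := n!/\prod_{x \in \mathcal{X}} m_x!$. The $\mathcal{X}$-simplex is $\Sigma := \{\boldsymbol{\theta} \in \mathbb{R}^{\mathcal{X}} : \theta_x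 \geq 0 \text{ for all } x \in \mathcal{X},\ \sum_{x \in \mathcal{X}} \theta_x = 1\}$. For $\boldsymbol{\theta} \in \Sigma$, $f \in \mathcal{L}(\mathcal{X}^n)$ and $g \in \mathcal{L}(\mathcal{N}^n)$, $$Mn^n(f|\boldsymbol{\theta}) := \sum_{\mathbf{z} \in \mathcal{X}^n} f(\mathbf{z}) \prod_{x \in \mathcal{X}} \theta_x^{T^n_x(\mathbf{z})}, \qquad CoMn^n(g|\boldsymbol{\theta}) := \sum_{\mathbf{m} \in \mathcal{N}^n} g(\mathbf{m})\,\nu(\mathbf{m}) \prod_{x \in \mathcal{X}} \theta_x^{m_x}.$$ $\mathcal{V}(\Sigma) := \{CoMn^n(g|\cdot) : n \geq 1, g \in \mathcal{L}(\mathcal{N}^n)\} = \{Mn^n(f|\cdot) : n \geq 1, f \in \mathcal{L}(\mathcal{X}^n)\}$ is the linear space of all (restrictions to $\Sigma$ of) real polynomial functions on $\Sigma$. *)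

(* Defs.v *)
From mathcomp Require Import all_boot all_order all_algebra perm.
From mathcomp Require Import all_classical all_reals all_analysis.

Set Implicit Arguments.
Unset Strict Implicit.
Unset Printing Implicit Defensive.

Import Order.TTheory GRing.Theory Num.Theory.
Import numFieldNormedType.Exports.

Local Open Scope classical_set_scope.
Local Open Scope ring_scope.

Section LowerPrevisions.
Variables (R : realType) (Y : Type).

Definition gambles : set (Y -> R) := bounded_fun.

Definition linear_space_of_gambles (K : set (Y -> R)) : Prop :=
  [/\ K `<=` gambles,
      K (fun=> 0),
      forall f g, K f -> K g -> K (f \+ g)
    & forall (l : R) f, K f -> K (fun y => l * f y)].

(* A lower prevision on K is represented by a function defined on all maps
   Y -> R; its values outside K are junk, are constrained by nothing below, and
   two such functions are the same lower prevision on K when they agree on K.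
   The infimum is the real-valued one, meaningful because Y is nonempty and f is
   bounded wherever this is used. *)
Definition coherent (K : set (Y -> R)) (P : (Y -> R) -> R) : Prop :=
  [/\ linear_space_of_gambles K,
      forall f, K f -> inf (range f) <= P f,
      forall (l : R) f, 0 <= l -> K f -> P (fun y => l * f y) = l * P f
    & forall f g, K f -> K g -> P f + P g <= P (f \+ g)].

End LowerPrevisions.

Arguments gambles {R Y}.

Section Sequences.
Variables (R : realType) (X : finType).

(* X^n is {ffun 'I_n -> X}, with positions numbered from 0. *)
Definition permute n (s : 'S_n) (z : {ffun 'I_n -> X}) : {ffun 'I_n -> X} :=
  [ffun k => z (s k)].

Definition exchangeable n (P : ({ffun 'I_n -> X} -> R) -> R) : Prop :=
  forall f (s : 'S_n), gambles f -> 0 <= P (fun z => f (permute s z) - f z).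

Definition prefix_of n k (z : {ffun 'I_(n + k) -> X}) : {ffun 'I_n -> X} :=
  [ffun i => z (lshift k i)].

(* The family is indexed by all n : nat, but its member at 0 is irrelevant. *)
Definition time_consistent
    (P : forall n : nat, ({ffun 'I_n -> X} -> R) -> R) : Prop :=
  forall n k f, (0 < n)%N -> gambles f ->
    P n f = P (n + k)%N (fun z => f (prefix_of z)).

(* The components of a count vector of total n are at most n, so bounding them
   in the type loses nothing and makes the set of count vectors a finType. *)
Definition count_vector n : predArgType :=
  {m : {ffun X -> 'I_n.+1} | (\sum_x m x == n)%N}.

Definition component n (m : count_vector n) (x : X) : nat := val m x.

Definition occurrences n (z : {ffun 'I_n -> X}) (x : X) : nat :=
  #|[pred k | z k == x]|.

Lemma occurrences_lt n (z : {ffun 'I_n -> X}) x : (occurrences z x < n.+1)%N.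
Proof. by rewrite ltnS -[leqRHS]card_ord max_card. Qed.

Definition occurrence_fun n (z : {ffun 'I_n -> X}) : {ffun X -> 'I_n.+1} :=
  [ffun x => Ordinal (occurrences_lt z x)].

Lemma occurrence_fun_sum n (z : {ffun 'I_n -> X}) :
  (\sum_x occurrence_fun z x == n)%N.
Proof.
apply/eqP; under eq_bigr do rewrite ffunE /= /occurrences -sum1_card.
by rewrite -[RHS]card_ord -sum1_card [RHS](partition_big z xpredT).
Qed.

Definition counting_map n (z : {ffun 'I_n -> X}) : count_vector n :=
  exist _ (occurrence_fun z) (occurrence_fun_sum z).

Definition count_distribution n (P : ({ffun 'I_n -> X} -> R) -> R)
    (h : count_vector n -> R) : R :=
  P (h \o @counting_map n).

Definition multinomial_coef n (m : count_vector n) : R :=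
  (n`!)%:R / (\prod_x (component m x)`!)%:R.

Definition simplex : Type :=
  {theta : {ffun X -> R} |
    [forall x, 0 <= theta x] && (\sum_x theta x == 1)}.

Definition Mn n (f : {ffun 'I_n -> X} -> R) (theta : simplex) : R :=
  \sum_z f z * \prod_x val theta x ^+ component (counting_map z) x.

Definition CoMn n (g : count_vector n -> R) (theta : simplex) : R :=
  \sum_m g m * multinomial_coef m * \prod_x val theta x ^+ component m x.

Definition polynomial_gambles : set (simplex -> R) :=
  [set p | exists n (g : count_vector n -> R),
    [/\ (0 < n)%N, gambles g & p = CoMn g]].

Definition represents (P : forall n : nat, ({ffun 'I_n -> X} -> R) -> R)
    (L : (simplex -> R) -> R) : Prop :=
  forall n, (0 < n)%N ->
    (forall f : {ffun 'I_n -> X} -> R, gambles f -> P n f = L (Mn f)) /\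
    (forall g : count_vector n -> R, gambles g ->
       count_distribution (P n) g = L (CoMn g)).

End Sequences.

Arguments polynomial_gambles {R X}.

(* Main.v *)
Require Import Defs.
From mathcomp Require Import all_boot all_order all_algebra perm.
From mathcomp Require Import all_classical all_reals all_analysis.
From mathcomp Require Import zify lra.

Set Implicit Arguments.
Unset Strict Implicit.
Unset Printing Implicit Defensive.

Import Order.TTheory GRing.Theory Num.Theory.

Local Open Scope ring_scope.

(* The only candidate is [L (Mn n f) := P n f]. Prefixing preserves both [Mn]
   and [P], so [f] and [f'] with the same polynomial can be compared on sequences
   of a common length [N]; there their difference sums to zero over each
   permutation class, and exchangeability makes [P] agree on them.

   The one nontrivial coherence axiom is [inf p <= L p]. For [N >= n],
   [N ^ n * f (prefix z)] is a sum over all maps [phi] from 'I_n to 'I_N;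
   exchangeability allows replacing [f (prefix z)] by [f (z \o phi)] in the
   terms with [phi] injective. The full sum of the [f (z \o phi)] is [N ^ n]
   times the value of [Mn f] at the frequency vector of [z], and the at most
   [n ^ 2 * N ^ (n - 1)] non-injective [phi] contribute an error which is
   negligible as [N] grows. *)

(** * Gambles on finite sets, base expansions, and counts of injective maps *)

Lemma gambles_finType (R : realType) (T : finType) (f : T -> R) : gambles f.
Proof.
exists (\sum_t `|f t|); split; first exact: num_real.
move=> M ltM t _ /=; apply: le_trans (ltW ltM).
by rewrite (bigD1 t) //= lerDl sumr_ge0.
Qed.

(** Reduction modulo [b] isolates the lowest digit, and induction handles the quotient. This
    separates monomials after Kronecker substitution. *)
Lemma base_digits_inj (b r : nat) (d d' : 'I_r -> nat) :
  (forall i, (d i < b)%N) -> (forall i, (d' i < b)%N) ->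
  (\sum_i d i * b ^ i = \sum_i d' i * b ^ i)%N -> d =1 d'.
Proof.
elim: r d d' => [|r IHr] d d' ltd ltd' eqdd'; first by case.
have tailE (c : 'I_r.+1 -> nat) :
    (\sum_i c i * b ^ i = c ord0 + (\sum_(i < r) c (lift ord0 i) * b ^ i) * b)%N.
  rewrite big_ord_recl /= muln1 big_distrl /=; congr (_ + _)%N.
  by apply: eq_bigr => i _; rewrite expnSr mulnA.
have b0 : (0 < b)%N by apply: leq_trans (ltd ord0).
rewrite !{}tailE in eqdd'.
have eq0 : d ord0 = d' ord0.
  by move/(congr1 (modn^~ b)): eqdd'; rewrite !(addnC (_ ord0)) !modnMDl !modn_small.
have /IHr-eqS : (\sum_(i < r) d (lift ord0 i) * b ^ i =
                 \sum_(i < r) d' (lift ord0 i) * b ^ i)%N.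
  by move/eqP: eqdd'; rewrite eq0 eqn_add2l eqn_pmul2r// => /eqP.
by move=> i; case: (fintype.unliftP ord0 i) => [j|] -> //; apply: eqS.
Qed.

(** Positions are corrected one at a time by a transposition; injectivity of [s] and [phi] shows
    that it moves no image already fixed. *)
Lemma perm_extends_inj n k (phi : {ffun 'I_n -> 'I_(n + k)}) :
  injective phi -> exists s : 'S_(n + k), forall i, s (lshift k i) = phi i.
Proof.
move=> inj_phi; suff /(_ n (leqnn n))[s sE] : forall j, (j <= n)%N ->
    exists s : 'S_(n + k), forall i : 'I_n, (i < j)%N -> s (lshift k i) = phi i.
  by exists s => i; apply: sE.
elim=> [|j IHj] ltjn; first by exists 1%g.
have [s sE] := IHj (ltnW ltjn); pose j' := Ordinal ltjn.
exists (s * tperm (s (lshift k j')) (phi j'))%g => i; rewrite ltnS permM.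
rewrite leq_eqVlt => /predU1P[ij|ltij].
  by rewrite (_ : i = j') ?tpermL //; apply: val_inj.
have nij : j' != i by rewrite -val_eqE /= gtn_eqF.
rewrite -(sE i) // tpermD //; first by rewrite (inj_eq perm_inj) (inj_eq (@lshift_inj _ _)).
by rewrite sE // (inj_eq inj_phi).
Qed.

(** Bounds the number [N ^ n - N ^_ n] of non-injective maps by [n ^ 2 * N ^ (n - 1)]; the extra
    factor [N] removes the exponent [n - 1]. *)
Lemma leq_expn_ffact (N n : nat) :
  (n <= N -> N * N ^ n <= N * N ^_ n + n * n * N ^ n)%N.
Proof.
elim: n => [|n IHn] ltnN; first by rewrite ffactn0 expn0 addn0.
have := IHn (ltnW ltnN); rewrite ffactnSr expnSr.
have : (N ^_ n <= N ^ n)%N.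
  elim: n {IHn ltnN} => [|m IHm]; first by rewrite ffactn0.
  by rewrite ffactnSr expnSr leq_mul // leq_subr.
move: (N ^_ n)%N (N ^ n)%N => a b leab leNb.
rewrite [(b * N)%N]mulnC !(mulnCA _ N) -mulnDr leq_mul2l; apply/orP; right.
move: leNb; rewrite -(subnKC (ltnW ltnN)) addKn; move: (N - n)%N => d; nia.
Qed.

(** * Concatenated sequences, occurrence counts and points of the simplex *)

Section Samples.
Variables (R : realType) (X : finType).
Implicit Types (n k : nat) (a : X -> R).

Definition concat n k (u : {ffun 'I_n -> X}) (v : {ffun 'I_k -> X}) :
    {ffun 'I_(n + k) -> X} :=
  [ffun i => match fintype.split i with inl j => u j | inr j => v j end].

Lemma concat_lshift n k (u : {ffun 'I_n -> X}) (v : {ffun 'I_k -> X}) i :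
  concat u v (lshift k i) = u i.
Proof. by rewrite ffunE -[lshift k i]/(unsplit (inl i)) unsplitK. Qed.

Lemma concat_rshift n k (u : {ffun 'I_n -> X}) (v : {ffun 'I_k -> X}) j :
  concat u v (rshift n j) = v j.
Proof. by rewrite ffunE -[rshift n j]/(unsplit (inr j)) unsplitK. Qed.

Lemma sum_concat (V : nmodType) n k (F : {ffun 'I_(n + k) -> X} -> V) :
  \sum_z F z = \sum_u \sum_v F (concat u v).
Proof.
rewrite pair_big /=.
rewrite (reindex (fun p => concat p.1 p.2)) //=.
exists (fun z => (prefix_of z, [ffun j => z (rshift n j)])) => [[u v] _|z _] /=.
  by congr (_, _); apply/ffunP => i; rewrite !ffunE -?[lshift _ _]/(unsplit (inl _))
    -?[rshift _ _]/(unsplit (inr _)) unsplitK.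
apply/ffunP => i; rewrite -[i]splitK; case: (fintype.split i) => j /=.
  by rewrite concat_lshift !ffunE.
by rewrite concat_rshift ffunE.
Qed.

Lemma prod_occurrences n a (z : {ffun 'I_n -> X}) :
  \prod_x a x ^+ occurrences z x = \prod_k a (z k).
Proof.
rewrite [RHS](partition_big z xpredT) //=; apply: eq_bigr => x _.
by rewrite (eq_bigr (fun=> a x)) ?prodr_const // => k /eqP->.
Qed.

Lemma sum_prod n a : \sum_(z : {ffun 'I_n -> X}) \prod_k a (z k) = (\sum_x a x) ^+ n.
Proof.
by rewrite -(bigA_distr_bigA (fun (_ : 'I_n) x => a x)) prodr_const card_ord.
Qed.

Lemma component_counting_map n (z : {ffun 'I_n -> X}) x :
  component (counting_map z) x = occurrences z x.
Proof. by rewrite /component /= ffunE. Qed.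

Lemma counting_map_eqP n (z w : {ffun 'I_n -> X}) :
  reflect (occurrences z =1 occurrences w) (counting_map z == counting_map w).
Proof.
apply: (iffP eqP) => [zw x|zw]; first by rewrite -!component_counting_map zw.
by apply: val_inj; apply/ffunP => x; apply: val_inj; rewrite /= !ffunE /=.
Qed.

Lemma occurrencesE n (z : {ffun 'I_n -> X}) x :
  occurrences z x = (\sum_k (z k == x))%N.
Proof. by rewrite /occurrences -sum1_card big_mkcond. Qed.

Lemma MnE n (f : {ffun 'I_n -> X} -> R) (theta : simplex R X) :
  Mn f theta = \sum_z f z * \prod_k val theta (z k).
Proof.
apply: eq_bigr => z _; rewrite -prod_occurrences.
by under eq_bigr do rewrite component_counting_map.
Qed.

Lemma simplex_sum1 (theta : simplex R X) : \sum_x val theta x = 1.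
Proof. by case: theta => t /= /andP[_ /eqP]. Qed.

Lemma simplex_ge0 (theta : simplex R X) x : 0 <= val theta x.
Proof. by case: theta => t /= /andP[/forallP]. Qed.

Lemma simplex_of_weights a : (forall x, 0 <= a x) -> 0 < \sum_x a x ->
  exists theta : simplex R X, forall x, val theta x = a x / \sum_y a y.
Proof.
move=> a0 s0; pose t := [ffun x => a x / \sum_y a y].
have t_simplex : [forall x, 0 <= t x] && (\sum_x t x == 1).
  apply/andP; split; first by apply/forallP => x; rewrite ffunE divr_ge0 // ltW.
  by under eq_bigr do rewrite ffunE; rewrite -mulr_suml divff // gt_eqF.
by exists (exist _ t t_simplex) => x /=; rewrite ffunE.
Qed.

(** The trailing [k] positions are summed out and contribute the [k]-th power of the total mass
    1. *)
Lemma Mn_prefix n k (f : {ffun 'I_n -> X} -> R) :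
  Mn (fun z => f (@prefix_of X n k z)) = Mn f.
Proof.
apply/funext => theta; rewrite !MnE sum_concat; apply: eq_bigr => u _.
have pu v : prefix_of (@concat n k u v) = u.
  by apply/ffunP => i; rewrite ffunE concat_lshift.
transitivity (\sum_(v : {ffun 'I_k -> X})
    f u * (\prod_i val theta (u i)) * \prod_j val theta (v j)).
  apply: eq_bigr => v _; rewrite pu -mulrA big_split_ord /=.
  congr (_ * (_ * _)); apply: eq_bigr => i _.
    by rewrite concat_lshift.
  by rewrite concat_rshift.
by rewrite -mulr_sumr sum_prod simplex_sum1 expr1n mulr1.
Qed.

(** * Multinomial polynomials that vanish on the simplex *)

Lemma Mn_sum_positive n (f : {ffun 'I_n -> X} -> R) a :
  (0 < #|X|)%N -> (forall x, 0 < a x) -> Mn f = (fun=> 0) ->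
  \sum_z f z * \prod_k a (z k) = 0.
Proof.
move=> /card_gt0P[x0 _] a0 f0.
have s0 : 0 < \sum_x a x.
  by rewrite (bigD1 x0) //= ltr_pwDl // sumr_ge0 // => x _; exact: ltW.
have [theta thetaE] := simplex_of_weights (fun x => ltW (a0 x)) s0.
(* Homogeneity of degree [n]: the value at [a] is the value at the normalised point [theta] times
   the [n]-th power of the total weight. *)
transitivity (Mn f theta * (\sum_x a x) ^+ n); last by rewrite f0 mul0r.
rewrite MnE mulr_suml; apply: eq_bigr => z _.
rewrite -mulrA; congr (_ * _); under [X in _ = X * _]eq_bigr do rewrite thetaE.
by rewrite big_split /= prodr_const card_ord -mulrA -exprMn mulVf ?gt_eqF// expr1n mulr1.
Qed.

Lemma poly_eq0 (p : {poly R}) : (forall t, 0 < t -> p.[t] = 0) -> p = 0.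
Proof.
move=> p0; apply/eqP/negPn/negP => p_neq0.
(* The roots [1, ..., size p] are more than the degree of a nonzero [p] allows. *)
pose rs : seq R := [seq i.+1%:R | i <- iota 0 (size p)].
suff: (size rs < size p)%N by rewrite size_map size_iota ltnn.
apply: max_poly_roots => //; last first.
  by rewrite map_inj_uniq ?iota_uniq // => i j /eqP; rewrite eqr_nat => /eqP[].
by apply/allP => _ /mapP[i _ ->]; apply/rootP/p0.
Qed.

(* Kronecker substitution [theta x = t ^ ((n + 1) ^ rank x)] turns a polynomial
   of degree n in several variables into one in the variable t, and sends
   distinct monomials to distinct monomials. *)
Lemma Mn_eq0_sum n (f : {ffun 'I_n -> X} -> R) (m : count_vector X n) :
  (0 < #|X|)%N -> Mn f = (fun=> 0) -> \sum_(z | counting_map z == m) f z = 0.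
Proof.
move=> X0 f0; pose e x := (n.+1 ^ @enum_rank X x)%N.
pose code (z : {ffun 'I_n -> X}) := (\sum_k e (z k))%N.
pose p := \sum_z f z *: 'X^(code z).
have p0 : p = 0.
  apply: poly_eq0 => t t0.
  rewrite horner_sum; under eq_bigr do rewrite hornerZ hornerXn expr_sum.
  by apply: (Mn_sum_positive (a := fun x => t ^+ e x)) => // x; apply: exprn_gt0.
have codeE z : code z = (\sum_(i < #|X|) occurrences z (enum_val i) * n.+1 ^ i)%N.
  rewrite /code (partition_big z xpredT) //= (reindex (@enum_val X xpredT)) /=; last first.
    by apply: onW_bij; exact: enum_val_bij.
  apply: eq_bigr => i _; rewrite -sum_nat_const; apply: eq_big => // k /eqP ->.
  by rewrite /e enum_valK.
have [[w /eqP wm]|no_z] := pselect (exists z, counting_map z == m); last first.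
  by rewrite big1 // => z zm; case: no_z; exists z.
(* This coefficient collects exactly the class of [w]: occurrence counts are at most [n], hence they
   are the digits of [code] in base [n + 1]. *)
transitivity (p`_(code w)); last by rewrite p0 coef0.
rewrite coef_sum [RHS](bigID (fun z => code z == code w)) /= [X in _ = _ + X]big1 ?addr0; last first.
  by move=> z zw; rewrite coefZ coefXn eq_sym (negPf zw) mulr0.
apply: eq_big => [z|z /eqP zm].
  rewrite -wm; apply/counting_map_eqP/eqP => [zw|].
    by rewrite !codeE; apply: eq_bigr => i _; rewrite zw.
  rewrite !codeE => /base_digits_inj zw x.
  by rewrite -(enum_rankK x) zw // => i; exact: occurrences_lt.
have -> : code z = code w.
  by rewrite !codeE; apply: eq_bigr => i _; move/eqP: zm; rewrite -wm => /counting_map_eqP->.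
by rewrite coefZ coefXn eqxx mulr1.
Qed.

(** * Sizes of permutation classes, and the passage between [Mn] and [CoMn] *)

Lemma occurrences_concat n k (u : {ffun 'I_n -> X}) (v : {ffun 'I_k -> X}) x :
  occurrences (concat u v) x = (occurrences u x + occurrences v x)%N.
Proof.
rewrite !occurrencesE big_split_ord /=; congr (_ + _)%N.
  by apply: eq_bigr => i _; rewrite concat_lshift.
by apply: eq_bigr => i _; rewrite concat_rshift.
Qed.

(** Splitting off the first entry [y] lowers the count of [y] by one, so [y] accounts for [c y * n!]
    of the product; the [c y] add up to [n + 1]. *)
Lemma card_occurrences n (c : X -> nat) : (\sum_x c x = n)%N ->
  (#|[pred z : {ffun 'I_n -> X} | [forall x, occurrences z x == c x]]|
     * \prod_x (c x)`! = n`!)%N.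
Proof.
elim: n c => [|n IHn] c sumc.
  have c0 x : c x = 0%N by apply/eqP; rewrite -leqn0 -sumc (bigD1 x) //= leq_addr.
  rewrite big1 ?muln1 => [|x _]; last by rewrite c0.
  rewrite -[RHS](_ : #|{ffun 'I_0 -> X}| = _)%N; last by rewrite card_ffun card_ord.
  apply: eq_card => z; rewrite !inE; apply/forallP => x.
  by rewrite c0 occurrencesE big_ord0.
have cardE k (Q : pred {ffun 'I_k -> X}) : #|[pred z | Q z]| = (\sum_z Q z)%N.
  by rewrite -sum1_card big_mkcond.
rewrite cardE (@sum_concat _ 1 n) /=.
rewrite (reindex (fun y => [ffun=> y])) /=; last first.
  exists (fun u : {ffun 'I_1 -> X} => u ord0) => [y _|u _]; first by rewrite ffunE.
  by apply/ffunP => i; rewrite ffunE (ord1 i).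
rewrite big_distrl factS -[in X in _ = X]sumc big_distrl /=; apply: eq_bigr => y _.
rewrite -cardE.
have occ v x : @occurrences X n.+1 (@concat 1 n [ffun=> y] v) x =
    ((y == x) + @occurrences X n v x)%N.
  by rewrite (@occurrences_concat 1 n) occurrencesE big_ord1 ffunE.
have [cy0|cy_gt0] := posnP (c y).
  rewrite cy0 mul0n eq_card0 ?mul0n // => v; rewrite !inE.
  by apply/negP => /forallP/(_ y); rewrite occ eqxx cy0.
pose c' x := (c x - (y == x))%N.
have c'E x : c x = ((y == x) + c' x)%N.
  by rewrite subnKC //; case: eqP => // <-.
have /IHn <- : (\sum_x c' x = n)%N.
  apply/eqP; rewrite -eqSS -sumc -add1n (eq_bigr _ (fun x _ => c'E x)) big_split /=.
  by rewrite eqn_add2r (bigD1 y) //= eqxx big1 // => x; rewrite eq_sym => /negPf->.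
rewrite mulnCA; congr (_ * _)%N.
  by apply: eq_card => v; rewrite !inE; apply: eq_forallb => x; rewrite occ c'E eqn_add2l.
rewrite (bigD1 y) // [in RHS](bigD1 y) //= mulnA; congr (_ * _)%N.
  by rewrite /c' eqxx subn1 -{1 2}(prednK cy_gt0) factS.
by apply: eq_bigr => x; rewrite /c' eq_sym => /negPf->; rewrite subn0.
Qed.

Lemma multinomial_coefE n (m : count_vector X n) :
  multinomial_coef R m = #|[pred z | counting_map z == m]|%:R.
Proof.
have fact_neq0 : (\prod_x (component m x)`!)%:R != 0 :> R.
  by rewrite pnatr_eq0 -lt0n prodn_gt0 // => x; exact: fact_gt0.
apply: (mulIf fact_neq0); rewrite /multinomial_coef divfK // -natrM; congr _%:R.
rewrite -(@card_occurrences n (component m)); last exact: (eqP (valP m)).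
congr (_ * _)%N; apply: eq_card => z; rewrite !inE.
apply/forallP/eqP => [zm|<- x]; last by rewrite component_counting_map.
apply: val_inj; apply/ffunP => x; apply: val_inj; rewrite ffunE; exact/eqP/zm.
Qed.

Lemma multinomial_coef_neq0 n (m : count_vector X n) : multinomial_coef R m != 0.
Proof.
rewrite mulf_neq0 // ?invr_eq0 pnatr_eq0 -lt0n ?fact_gt0 //.
by rewrite prodn_gt0 // => x; exact: fact_gt0.
Qed.

(** The monomial of a sequence depends only on its count vector, and [multinomial_coef] is the size
    of each class. *)
Lemma Mn_counting_map n (g : count_vector X n -> R) : Mn (g \o @counting_map X n) = CoMn g.
Proof.
apply/funext => theta; rewrite /Mn (partition_big (@counting_map X n) xpredT) //=.
apply: eq_bigr => m _; rewrite multinomial_coefE.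
transitivity (\sum_(z | counting_map z == m) g m * \prod_x val theta x ^+ component m x).
  by apply: eq_bigr => z /eqP->.
by rewrite sumr_const -[RHS]mulrA mulr_natl -mulrnAr.
Qed.

Lemma polynomial_gamblesP (p : simplex R X -> R) : polynomial_gambles p <->
  exists n (f : {ffun 'I_n -> X} -> R), (0 < n)%N /\ p = Mn f.
Proof.
split=> [[n [g [n0 _ ->]]]|[n [f [n0 ->]]]].
  by exists n, (g \o @counting_map X n); rewrite Mn_counting_map.
(* The witness averages [f] over each permutation class. *)
exists n, (fun m => (\sum_(z | counting_map z == m) f z) / multinomial_coef R m).
split=> //; first exact: gambles_finType.
apply/funext => theta; rewrite /Mn (partition_big (@counting_map X n) xpredT) //=.
apply: eq_bigr => m _; rewrite divfK ?multinomial_coef_neq0 // mulr_suml.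
by apply: eq_bigr => z /eqP->.
Qed.

Lemma MnD n (f g : {ffun 'I_n -> X} -> R) : Mn (f \+ g) = Mn f \+ Mn g.
Proof.
by apply/funext => theta; rewrite /Mn /= -big_split; apply: eq_bigr => z _; rewrite mulrDl.
Qed.

Lemma MnZ n (l : R) (f : {ffun 'I_n -> X} -> R) :
  Mn (fun z => l * f z) = fun theta => l * Mn f theta.
Proof.
by apply/funext => theta; rewrite /Mn mulr_sumr; apply: eq_bigr => z _; rewrite mulrA.
Qed.

Lemma gambles_Mn n (f : {ffun 'I_n -> X} -> R) : gambles (Mn f).
Proof.
exists (\sum_z `|f z|); split; first exact: num_real.
move=> M ltM theta _ /=; apply: le_trans (ltW ltM).
rewrite MnE; apply: le_trans (ler_norm_sum _ _ _) _; apply: ler_sum => z _.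
rewrite normrM ler_piMr // normr_prod prodr_ile1 // => k _.
rewrite normr_ge0 ger0_norm ?simplex_ge0 //= -[leRHS](simplex_sum1 theta) (bigD1 (z k)) //=.
by rewrite lerDl sumr_ge0 // => x _; exact: simplex_ge0.
Qed.

Lemma counting_map_permute n (z w : {ffun 'I_n -> X}) :
  counting_map z = counting_map w -> exists s, permute s z = w.
Proof.
move/eqP/counting_map_eqP => zw.
have countE (v : {ffun 'I_n -> X}) x : count_mem x [tuple v i | i < n] = occurrences v x.
  rewrite count_map val_ord_tuple /occurrences cardE -size_filter.
  by rewrite {1}enumT.
have /tuple_permP[s sE] : perm_eq [tuple w i | i < n] [tuple z i | i < n].
  by apply/allP => x _ /=; rewrite !countE zw.
exists s; apply/ffunP => i; rewrite ffunE.
have /(congr1 (fun t => tnth t i)) := val_inj sE.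
by rewrite !tnth_mktuple.
Qed.

End Samples.

(** * Coherent lower previsions on a finite set *)

Section CoherentOnFinType.
Variables (R : realType) (T : finType) (P : (T -> R) -> R).
Hypothesis P_coherent : coherent gambles P.

Lemma coherent_ge (c : R) (f : T -> R) (t0 : T) : (forall t, c <= f t) -> c <= P f.
Proof.
case: P_coherent => _ P1 _ _ cf.
(* The point [t0] makes the range nonempty, so that its infimum is genuine. *)
apply: le_trans (P1 _ (gambles_finType f)); apply: lb_le_inf; first by exists (f t0), t0.
by move=> _ [t _ <-].
Qed.

Lemma coherentZ (l : R) (f : T -> R) : 0 <= l -> P (fun t => l * f t) = l * P f.
Proof. by case: P_coherent => _ _ P2 _ l0; apply: P2 => //; exact: gambles_finType. Qed.

Lemma coherentD (f g : T -> R) : P f + P g <= P (fun t => f t + g t).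
Proof. by case: P_coherent => _ _ _; apply; exact: gambles_finType. Qed.

Lemma coherent_le (f g : T -> R) : 0 <= P (fun t => f t - g t) -> P g <= P f.
Proof.
move=> fg0; have := coherentD g (fun t => f t - g t).
rewrite (_ : (fun t => g t + _) = f); last by apply/funext => t; rewrite addrC subrK.
by apply: le_trans; rewrite lerDl.
Qed.

Lemma coherent_sum_ge0 (I : finType) (F : I -> T -> R) :
  (forall i, 0 <= P (F i)) -> 0 <= P (fun t => \sum_i F i t).
Proof.
move=> F0; elim: (index_enum I) => [|i s IHs].
  (* Writing zero as [0 * 0] lets homogeneity with factor zero give the value 0. *)
  rewrite (_ : (fun t => \sum_(i <- [::]) F i t) = (fun t => 0 * 0)).
    by rewrite (coherentZ (fun=> 0)) ?mul0r.
  by apply/funext => t; rewrite big_nil mul0r.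
rewrite (_ : (fun t => \sum_(j <- i :: s) F j t) = (fun t => F i t + \sum_(j <- s) F j t)).
  by apply: le_trans (coherentD _ _); rewrite addr_ge0.
by apply/funext => t; rewrite big_cons.
Qed.

End CoherentOnFinType.

(** * Exchangeability at a fixed length *)

Section Exchangeable.
Variables (R : realType) (X : finType) (n : nat) (P : ({ffun 'I_n -> X} -> R) -> R).
Hypotheses (P_coherent : coherent gambles P) (P_exchangeable : exchangeable P).

Lemma permute_inj (s : 'S_n) : injective (@permute X n s).
Proof.
move=> z w /ffunP zw; apply/ffunP => k.
by have := zw (s^-1 k)%g; rewrite !ffunE permKV.
Qed.

(* [h] is the sum of the [h w (1_w - 1_(r w))], where [r w] is a fixed
   representative of the permutation class of [w]: the second terms add up to
   zero, and each difference has the form [f \o permute s - f]. *)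
Lemma exchangeable_ge0 (h : {ffun 'I_n -> X} -> R) :
  (forall m, \sum_(z | counting_map z == m) h z = 0) -> 0 <= P h.
Proof.
move=> h0; pose rep m := [pick z | @counting_map X n z == m].
have sum_rep z : \sum_w h w * (rep (counting_map w) == Some z)%:R = 0.
  rewrite (partition_big (@counting_map X n) xpredT) //= big1 // => m _.
  under eq_bigr => w /eqP-> do [].
  by rewrite -mulr_suml h0 mul0r.
rewrite (_ : h = fun z =>
    \sum_w (h w * (w == z)%:R - h w * (rep (counting_map w) == Some z)%:R)); last first.
  apply/funext => z; rewrite big_split /= sumrN sum_rep subr0 (bigD1 z) //= eqxx mulr1.
  by rewrite big1 ?addr0 // => w /negPf->; rewrite mulr0.
apply: coherent_sum_ge0 => // w.
have [r rep_w rw] : exists2 r, rep (counting_map w) = Some r & counting_map r = counting_map w.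
  by rewrite /rep; case: pickP => [r /eqP|/(_ w)]; [exists r | rewrite eqxx].
have [s sw] := counting_map_permute (esym rw).
(* Since [permute s w = r], the indicator of [r] composed with [permute s] is the indicator of
   [w]. *)
have := P_exchangeable s (gambles_finType (fun z => h w * (r == z)%:R)).
congr (_ <= P _); apply/funext => z.
by rewrite rep_w -sw (inj_eq (@permute_inj s)).
Qed.

Lemma exchangeable_eq_Mn (f g : {ffun 'I_n -> X} -> R) :
  (0 < #|X|)%N -> Mn f = Mn g -> P f = P g.
Proof.
move=> X0 fg; suff le_Mn f' g' : Mn f' = Mn g' -> P g' <= P f'.
  by apply/eqP; rewrite eq_le !le_Mn.
move=> f'g'; apply: coherent_le => //; apply: exchangeable_ge0 => m.
apply: Mn_eq0_sum => //; apply/funext => theta.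
have -> : (fun t => f' t - g' t) = f' \+ (fun t => - 1 * g' t).
  by apply/funext => t /=; rewrite mulN1r.
by rewrite MnD MnZ /= f'g' mulN1r subrr.
Qed.

End Exchangeable.

(** * Time-consistent families and the bound from below *)

Section TimeConsistent.
Variables (R : realType) (X : finType).
Variable P : forall n : nat, ({ffun 'I_n -> X} -> R) -> R.
Arguments P {n}.
Hypothesis X_nonempty : (0 < #|X|)%N.
Hypothesis P_coherent : forall n, (0 < n)%N -> coherent gambles (@P n).
Hypothesis P_exchangeable : forall n, (0 < n)%N -> exchangeable (@P n).
Hypothesis P_consistent : time_consistent (@P).

Lemma common_length n n' (f : {ffun 'I_n -> X} -> R) (f' : {ffun 'I_n' -> X} -> R) :
  (0 < n)%N -> (0 < n')%N ->
  exists N (h h' : {ffun 'I_N -> X} -> R),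
    [/\ (0 < N)%N, P f = P h, P f' = P h', Mn f = Mn h & Mn f' = Mn h'].
Proof.
move=> n0 n0'; have [h' [Ph' Mh']] : exists h' : {ffun 'I_(n + n') -> X} -> R,
    P f' = P h' /\ Mn f' = Mn h'.
  rewrite addnC; exists (fun z => f' (prefix_of z)).
  by rewrite Mn_prefix -P_consistent //; exact: gambles_finType.
exists (n + n')%N, (fun z => f (prefix_of z)), h'.
by rewrite addn_gt0 n0 Mn_prefix -P_consistent //; exact: gambles_finType.
Qed.

Lemma eq_Mn_eq n n' (f : {ffun 'I_n -> X} -> R) (f' : {ffun 'I_n' -> X} -> R) :
  (0 < n)%N -> (0 < n')%N -> Mn f = Mn f' -> P f = P f'.
Proof.
move=> n0 n0'; have [N [h [h' [N0 -> -> -> ->]]]] := common_length f f' n0 n0'.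
exact: (exchangeable_eq_Mn (P_coherent N0) (P_exchangeable N0)).
Qed.

(* Evaluating [Mn f] at the vector of frequencies of [z] amounts to sampling
   from the urn [z] with replacement. *)
Lemma Mn_frequencies n N (f : {ffun 'I_n -> X} -> R) (z : {ffun 'I_N -> X}) :
  (0 < N)%N -> exists theta : simplex R X,
    Mn f theta * N%:R ^+ n = \sum_(phi : {ffun 'I_n -> 'I_N}) f [ffun i => z (phi i)].
Proof.
move=> N0; pose a x : R := (occurrences z x)%:R.
have sum_a : \sum_x a x = N%:R.
  rewrite -natr_sum -[in RHS](eqP (occurrence_fun_sum z)); congr _%:R.
  by apply: eq_bigr => x _; rewrite ffunE.
have sum_a_gt0 : 0 < \sum_x a x by rewrite sum_a ltr0n.
have [theta thetaE] := simplex_of_weights (fun x => ler0n _ _) sum_a_gt0.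
exists theta; rewrite MnE mulr_suml.
rewrite (partition_big (fun phi : {ffun 'I_n -> 'I_N} => [ffun i => z (phi i)]) xpredT) //=.
apply: eq_bigr => w _.
transitivity (f w * \prod_i a (w i)).
  rewrite -mulrA; congr (_ * _); under eq_bigr do rewrite thetaE sum_a.
  rewrite big_split /= prodr_const card_ord -mulrA -exprMn mulVf ?expr1n ?mulr1 //.
  by rewrite pnatr_eq0 -lt0n.
(* The product of counts expands into a sum over all [phi] of products of indicators, equal to 1
   when [z \o phi] is [w] and to 0 otherwise. *)
under eq_bigr do rewrite /a occurrencesE natr_sum.
rewrite (bigA_distr_bigA (fun i k => (z k == w i)%:R)) mulr_sumr [RHS]big_mkcond /=.
apply: eq_bigr => phi _.
have [<-|phi_w] := eqVneq [ffun i => z (phi i)] w; first by rewrite big1 ?mulr1 // => i _; rewrite ffunE eqxx.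
have [i /negPf zw] : exists i, z (phi i) != w i.
  apply/existsP; apply: contraNT phi_w => /existsPn zw; apply/eqP/ffunP => i.
  by rewrite ffunE; apply/eqP; rewrite -[_ == _]negbK zw.
by rewrite (bigD1 i) //= zw mul0r mulr0.
Qed.

(** If [s] extends [phi], permuting by the inverse of [s] turns [z \o phi] into the prefix of
    [z]. *)
Lemma exchangeable_sample n k (f : {ffun 'I_n -> X} -> R) (phi : {ffun 'I_n -> 'I_(n + k)}) :
  (0 < n)%N -> injective phi ->
  0 <= P (fun z : {ffun 'I_(n + k) -> X} =>
            f (prefix_of z) - f [ffun i => z (phi i)]).
Proof.
move=> n0 /perm_extends_inj[s sE].
have nk0 : (0 < n + k)%N by rewrite addn_gt0 n0.
have := P_exchangeable nk0 (s^-1)%g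
  (gambles_finType (fun z : {ffun 'I_(n + k) -> X} => f [ffun i => z (phi i)])).
congr (_ <= P _); apply/funext => z; congr (f _ - _).
by apply/ffunP => i; rewrite !ffunE -sE permK.
Qed.

Lemma lower_bound_Mn n (f : {ffun 'I_n -> X} -> R) (c : R) :
  (0 < n)%N -> (forall theta, c <= Mn f theta) -> c <= P f.
Proof.
move=> n0 cf; have /card_gt0P[x0 _] := X_nonempty.
pose M : R := \sum_u `|f u|; have M0 : 0 <= M + M by rewrite addr_ge0 ?sumr_ge0.
have fM u v : - (M + M) <= f u - f v.
  have leM w : `|f w| <= M by rewrite /M (bigD1 w) //= lerDl sumr_ge0.
  have := leM u; have := leM v; rewrite !ler_norml => /andP[_ ?] /andP[? _].
  by rewrite opprD lerD // lerN2.
suff bound k : (n + k)%:R * (c - P f) <= (M + M) * (n * n)%:R.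
  (* The right side of [bound] is independent of [k], so a positive [c - P f] is refuted by a large
     [k]. *)
  rewrite leNgt; apply/negP => ltPc; have d0 : 0 < c - P f by rewrite subr_gt0.
  set B := (M + M) * (n * n)%:R in bound.
  have B0 : 0 <= B / (c - P f).
    by rewrite divr_ge0 ?(ltW d0) // /B mulr_ge0 ?ler0n // M0.
  have := archi_boundP B0; rewrite ltr_pdivrMr // ltNge => /negP; apply.
  by apply: le_trans (bound (Num.bound (B / (c - P f)))); rewrite ler_pM2r // ler_nat leq_addl.
set N := (n + k)%N; have N0 : (0 < N)%N by rewrite addn_gt0 n0.
have coh := P_coherent N0.
pose F (z : {ffun 'I_N -> X}) := f (prefix_of z).
pose S (phi : {ffun 'I_n -> 'I_N}) (z : {ffun 'I_N -> X}) := f [ffun i => z (phi i)].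
have PF : P f = P F by apply: P_consistent => //; exact: gambles_finType.
(* The two integrands add up to [N ^ n] copies of [F]; superadditivity separates the sampling
   correction from the sampled sum. *)
have split_P : P (fun z => \sum_(phi : {ffun 'I_n -> 'I_N}) (if injectiveb phi then F z - S phi z else 0)) +
    P (fun z => \sum_(phi : {ffun 'I_n -> 'I_N}) (if injectiveb phi then S phi z else F z)) <= N%:R ^+ n * P f.
  rewrite PF -(coherentZ coh) ?exprn_ge0 ?ler0n //.
  apply: le_trans (coherentD coh _ _) _; rewrite le_eqVlt; apply/orP; left; apply/eqP.
  congr (P _); apply/funext => z; rewrite -big_split /=.
  rewrite (eq_bigr (fun=> F z)) => [|phi _]; last by case: ifP => _; rewrite ?subrK ?add0r.
  by rewrite sumr_const card_ffun !card_ord -natrX mulr_natl.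
have inj_part : 0 <= P (fun z : {ffun 'I_N -> X} =>
    \sum_(phi : {ffun 'I_n -> 'I_N}) (if injectiveb phi then F z - S phi z else 0)).
  apply: (@coherent_sum_ge0 _ _ _ coh) => phi; case: injectiveP => [inj_phi|_].
    exact: exchangeable_sample.
  exact: (coherent_ge coh [ffun=> x0]).
have card_noninj :
    #|[pred phi : {ffun 'I_n -> 'I_N} | ~~ injectiveb phi]| = (N ^ n - N ^_ n)%N.
  have := cardC [pred phi : {ffun 'I_n -> 'I_N} | injectiveb phi].
  rewrite card_ffun !card_ord => <-.
  rewrite -[X in (_ - X)%N](_ : #|[set phi : {ffun 'I_n -> 'I_N} | injectiveb phi]| = _).
    by rewrite cardsE addKn.
  by rewrite card_inj_ffuns !card_ord.
(* The sum of all [S phi z] is at least [N ^ n * c], and replacing [S phi z] by [F z] costs at most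
   [M + M] per non-injective [phi]. *)
have noninj_part : N%:R ^+ n * c - (M + M) * (N ^ n - N ^_ n)%:R <=
    P (fun z => \sum_(phi : {ffun 'I_n -> 'I_N}) (if injectiveb phi then S phi z else F z)).
  apply: (coherent_ge coh [ffun=> x0]) => z.
  have [theta thetaE] := Mn_frequencies f z N0.
  have := ler_wpM2r (exprn_ge0 n (ler0n R N)) (cf theta); rewrite {}thetaE mulrC => le_c.
  rewrite lerBlDr; apply: le_trans le_c _; rewrite -lerBlDl -sumrB.
  rewrite -card_noninj -sum1_card natr_sum mulr_sumr [leRHS]big_mkcond /=.
  apply: ler_sum => phi _; rewrite unfold_in /=; case: injectiveP => _ /=.
    by rewrite subrr.
  by rewrite mulr1 -lerN2 opprB fM.
have := leq_expn_ffact (leq_addr k n); rewrite -/N => leN.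
have expN_gt0 : 0 < N%:R ^+ n :> R by rewrite exprn_gt0 // ltr0n.
(* Multiplying by [N ^ n] brings the goal to the scale of the counting bound. *)
rewrite -(ler_pM2r expN_gt0).
have : N%:R * (N ^ n - N ^_ n)%:R <= (n * n)%:R * N%:R ^+ n :> R.
  by rewrite -natrX -!natrM ler_nat mulnBr leq_subLR.
move/(ler_wpM2l M0) => le_noninj.
have : N%:R ^+ n * c - (M + M) * (N ^ n - N ^_ n)%:R <= N%:R ^+ n * P f by lra.
move/(ler_wpM2l (ler0n R N)); lra.
Qed.

End TimeConsistent.

(** * The space of polynomial gambles and the representing lower prevision *)

Lemma linear_space_polynomial_gambles (R : realType) (X : finType) :
  linear_space_of_gambles (@polynomial_gambles R X).
Proof.
split=> [p|||].
- by move=> /polynomial_gamblesP[n [f [_ ->]]]; exact: gambles_Mn.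
- apply/polynomial_gamblesP; exists 1%N, (fun=> 0 * 0); split=> //.
  by rewrite MnZ; apply/funext => theta; rewrite mul0r.
- move=> p q /polynomial_gamblesP[n [f [n0 ->]]] /polynomial_gamblesP[n' [f' [n0' ->]]].
  apply/polynomial_gamblesP; exists (n + n')%N.
  have [g ->] : exists g : {ffun 'I_(n + n') -> X} -> R, Mn f' = Mn g.
    by rewrite addnC; exists (fun z => f' (prefix_of z)); rewrite Mn_prefix.
  exists ((fun z => f (prefix_of z)) \+ g).
  by rewrite addn_gt0 n0 MnD Mn_prefix.
- move=> l p /polynomial_gamblesP[n [f [n0 ->]]].
  by apply/polynomial_gamblesP; exists n, (fun z => l * f z); rewrite MnZ.
Qed.

Theorem theorem5 (R : realType) (X : finType) (X_nonempty : (0 < #|X|)%N)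
    (P : forall n : nat, ({ffun 'I_n -> X} -> R) -> R)
    (P_coherent : forall n : nat, (0 < n)%N -> coherent gambles (P n))
    (P_exchangeable : forall n : nat, (0 < n)%N -> exchangeable (P n))
    (P_consistent : time_consistent P) :
  exists L : (simplex R X -> R) -> R,
    [/\ coherent polynomial_gambles L,
        represents P L
      & forall L' : (simplex R X -> R) -> R,
          coherent polynomial_gambles L' -> represents P L' ->
          forall p, polynomial_gambles p -> L' p = L p].
Proof.
have eqP_Mn := eq_Mn_eq X_nonempty P_coherent P_exchangeable P_consistent.
(* [P n f] depends only on [Mn f], so the value is well defined; maps that are not polynomial leave
   it unconstrained. *)
have /boolp.choice[L LE] : forall p : simplex R X -> R, exists r,
    forall n (f : {ffun 'I_n -> X} -> R), (0 < n)%N -> p = Mn f -> r = P n f.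
  move=> p.
  have [[n [f [n0 pf]]]|no_f] := pselect (exists n (f : {ffun 'I_n -> X} -> R),
      (0 < n)%N /\ p = Mn f).
    exists (P n f) => n' f' n0' pf'; by apply: eqP_Mn => //; rewrite -pf.
  by exists 0 => n f n0 pf; case: no_f; exists n, f.
have L_represents : represents P L.
  move=> n n0; split=> [f _|g _]; first by rewrite (LE _ n f).
  by rewrite (LE _ n (g \o @counting_map X n)) ?Mn_counting_map.
exists L; split=> //.
  split; first exact: linear_space_polynomial_gambles.
  - move=> p /polynomial_gamblesP[n [f [n0 ->]]]; rewrite (LE _ n f) //.
    apply: (lower_bound_Mn X_nonempty P_coherent P_exchangeable P_consistent) => // theta.
    apply: ge_inf; last by exists theta.
    exact/bounded_fun_has_lbound/gambles_Mn.
  - move=> l p l0 /polynomial_gamblesP[n [f [n0 ->]]]; rewrite (LE (Mn f) n f) //.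
    by rewrite (LE _ n (fun z => l * f z)) ?MnZ // (coherentZ (P_coherent _ n0)).
  - move=> p q /polynomial_gamblesP[n [f [n0 ->]]] /polynomial_gamblesP[n' [f' [n0' ->]]].
    (* At a common length, superadditivity of the single functional [P N] applies. *)
    have [N [h [h' [N0 Pf Pf' Mf Mf']]]] := common_length P_consistent f f' n0 n0'.
    rewrite (LE (Mn f) n f) // (LE (Mn f') n' f') // (LE _ N (h \+ h')) ?MnD ?Mf ?Mf' // Pf Pf'.
    exact: (coherentD (P_coherent _ N0)).
(* Every polynomial gamble is some [CoMn g], where the count distribution fixes both values. *)
move=> L' _ L'_represents p [n [g [n0 g_bounded ->]]].
by rewrite -(L'_represents n n0).2 // -(L_represents n n0).2.
Qed.
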